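(* Let $T$ be a tree on $n$ vertices. Then $T$ is $e$-positive if and only if \[ b_{\lambda} \ge \left\lceil \frac{1}{\prod_{i=1}^{\ell(\lambda)} \lambda_i} \sum_{\substack{\mu \dashv \lambda \\ \ell(\mu) < \ell(\lambda)}} (-1)^{\ell(\lambda)-\ell(\mu)-1}\,b_{\mu}\,w(B_{\lambda,\mu})\right\rceil \] for every partition $\lambda=(\lambda_1,\dots,\lambda_{\ell(\lambda)})$ of $n$, where $b_\mu$ is the number of connected partitions of $T$ of type $\mu$.
   Context: Chromatic symmetric function: for a graph $G$ with vertices $v_1,\dots,v_n$, $X_G=\sum_\kappa x_{\kappa(v_1)}\cdots x_{\kappa(v_n)}$, the sum over all proper colorings $\kappa:V(G)\to\{1,2,\dots\}$. For a partition $\lambda=(\lambda_1,\dots,\lambda_\ell)$, $e_\lambda=e_{\lambda_1}\cdots e_{\lambda_\ell}$ with $e_k=\sum_{j_1<\cdots<j_k}x_{j_1}\cdots x_{j_k}$. A graph $G$ is $e$-positive if all coefficients of $X_G$ in the basis $\{e_\lambda\}$ are non-negative. Partitions: $\ell(\lambda)$ is the number of parts of $\lambda$; order of parts is irrelevant. Write $\mu\dashv\lambda$ if $\lambda$ is a refinement of $\mu$, i.e. $\lambda$ can be obtained from $\mu$ by splitting parts of $\mu$ (possibly splitting none). Connected partitions: a connected partition of a graph $G$ is a set partition $\{B_1,\dots,B_k\}$ of $V(G)$ such that each $B_i$ induces a connected subgraph; its type is the integer partition formed by $|B_1|,\dots,|B_k|$. $b_\mu$ is the number of connected partitions of type $\mu$.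 Brick tabloids: a brick tabloid of shape $\mu$ and content $\lambda$ is the Young diagram of $\mu$ (with $\mu_i$ left-justified boxes in the $i$-th row) with each row divided into bricks, each brick consisting of one or more consecutive boxes of that row, such that the multiset of lengths of all bricks is the multiset of parts of $\lambda$. $B_{\lambda,\mu}$ is the set of all such brick tabloids. The weight $w(T')$ of a brick tabloid $T'$ is the product over its rows of the length of the last (rightmost) brick in the row, and $w(B_{\lambda,\mu})=\sum_{T'\in B_{\lambda,\mu}}w(T')$. *)

(* Defs.v *)
From HB Require Import structures.
From mathcomp Require Import all_boot all_order all_algebra.
From mathcomp Require Import finmap monalg.
From mathcomp Require Import boolp classical_sets cardinality fsbigop.

Set Implicit Arguments.
Unset Strict Implicit.
Unset Printing Implicit Defensive.

Import Order.TTheory GRing.Theory Num.Theory.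

Local Open Scope classical_set_scope.
Local Open Scope ring_scope.

Definition is_intpart (s : seq nat) : bool :=
  sorted geq s && (0%N \notin s).

Record intpart := IntPart { parts :> seq nat; _ : is_intpart parts }.
HB.instance Definition _ := [isSub for parts].
HB.instance Definition _ := [Choice of intpart by <:].

(* mu -| la : the i-th list of ss records the pieces into which the i-th part
   of mu is split. *)
Definition refined_by (mu la : intpart) : Prop :=
  exists2 ss : seq (seq nat),
    [seq sumn s | s <- ss] = mu & perm_eq (flatten ss) la.

(* A tabloid is the list of its rows, a row being the list of its brick
   lengths from left to right.  As the parts of la are positive, so are the
   lengths of the bricks; as those of mu are positive, no row is empty. *)
Definition brick_tabloids (la mu : intpart) : set (seq (seq nat)) :=
  [set t | [seq sumn r | r <- t] = mu /\ perm_eq (flatten t) la].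

Definition tabloid_weight (t : seq (seq nat)) : nat :=
  (\prod_(r <- t) last 0 r)%N.

Definition brick_weight (la mu : intpart) : nat :=
  \sum_(t \in brick_tabloids la mu) tabloid_weight t.

(* Formal power series in the variables x_0, x_1, ..., given by their
   coefficients. *)
Definition powser := {cmonom nat} -> rat.

Definition powser_one : powser := fun m => (m == mone)%:R.

(* Infinite families are allowed as long as each monomial is hit finitely
   often; see colorings_fiber_finite and subsets_fiber_finite. *)
Definition monom_sum (I : choiceType) (A : set I) (f : I -> {cmonom nat})
  : powser := fun m => \sum_(i \in [set i | A i /\ f i = m]) (1 : rat).

Definition powser_mul (f g : powser) : powser :=
  fun m => \sum_(p \in [set p : {cmonom nat} * {cmonom nat} |
                         mmul p.1 p.2 = m]) f p.1 * g p.2.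

(* The index of summation J stands for the set {j_1 < ... < j_k}. *)
Definition elem_sym (k : nat) : powser :=
  monom_sum [set J : {fset nat} | #|` J| = k]
            (fun J => \big[mmul/mone]_(j <- J) ucm j).

Definition elem_sym_part (la : intpart) : powser :=
  foldr (fun k => powser_mul (elem_sym k)) powser_one la.

Definition e_expansion (f : powser) (c : {fsfun intpart -> rat with 0}) : Prop :=
  forall m, f m = \sum_(la <- finsupp c) c la * elem_sym_part la m.

Definition e_positive (f : powser) : Prop :=
  exists2 c, e_expansion f c & forall la, 0 <= c la.

(* All sums over infinite types in this development have finite support. *)
Lemma bounded_seqs_finite (T : eqType) (A : set T) (n : nat) :
  finite_set A ->
  finite_set [set s : seq T | (size s <= n)%N /\ {in s, forall i, A i}].
Proof.
move=> finA; elim: n => [|n IHn].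
  apply: (@sub_finite_set _ _ [set [::]]); last exact: finite_set1.
  by move=> [|x s] /= [].
set B := [set s | _] in IHn.
apply: (@sub_finite_set _ _ ([set [::]] `|` [set p.1 :: p.2 | p in A `*` B])).
  move=> [|x s] /= [szs As]; [by left | right].
  exists (x, s) => //; split => /=; first exact: As (mem_head x s).
  by split => // i si; apply: As; rewrite inE si orbT.
rewrite finite_setU; split; first exact: finite_set1.
by apply: finite_image; apply: finite_setX.
Qed.

Lemma finite_nat_le (n : nat) : finite_set [set i : nat | (i <= n)%N].
Proof.
apply: (sub_finite_set _ (finite_seq (iota 0 n.+1))) => i ilen.
by change (i \in iota 0 n.+1); rewrite mem_iota ltnS.
Qed.

Lemma leq_sumn (s : seq nat) (i : nat) : i \in s -> (i <= sumn s)%N.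
Proof.
elim: s => //= j s IHs; rewrite inE => /orP[/eqP ->|/IHs ile].
  exact: leq_addr.
by rewrite (leq_trans ile) ?leq_addl.
Qed.

Lemma brick_tabloids_finite (la mu : intpart) :
  finite_set (brick_tabloids la mu).
Proof.
apply: sub_finite_set
  (bounded_seqs_finite (size mu)
     (bounded_seqs_finite (size la) (finite_nat_le (sumn la)))).
move=> t /= [tmu tla]; split; first by rewrite -tmu size_map.
move=> r rt; split=> [|i ir].
  rewrite -(perm_size tla) size_flatten; apply: leq_sumn; exact: map_f.
by apply: leq_sumn; rewrite -(perm_mem tla); apply/flattenP; exists r.
Qed.

Lemma coarser_finite (la : intpart) :
  finite_set [set mu | refined_by mu la /\ (size mu < size la)%N].
Proof.
have inj_parts : injective parts by exact: val_inj.
apply: sub_finite_set (finite_preimage (in2W inj_parts)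
  (bounded_seqs_finite (size la) (finite_nat_le (sumn la)))).
move=> mu [[ss ssmu ssla] szmu]; split; first exact: ltnW.
move=> i; rewrite /= -ssmu => imu; rewrite -(perm_sumn ssla) sumn_flatten.
exact: leq_sumn.
Qed.

Lemma mmul_big_ucm (I : Type) (r : seq I) (f : I -> nat) (j : nat) :
  (\big[mmul/mone]_(i <- r) ucm (f i) : {cmonom nat}) j
  = count (fun i => f i == j) r.
Proof.
elim: r => [|i r IHr]; first by rewrite big_nil cm1.
by rewrite big_cons cmM cmU IHr.
Qed.

Lemma subsets_fiber_finite (k : nat) (m : {cmonom nat}) :
  finite_set [set J : {fset nat} | #|` J| = k
    /\ \big[mmul/mone]_(j <- J) ucm j = m].
Proof.
apply: (sub_finite_set _ (finite_fset (fpowerset (finsupp m)))).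
move=> J [_ Jm] /=; rewrite fpowersetE; apply/fsubsetP => j jJ.
by rewrite -cmE_neq0 -Jm mmul_big_ucm -lt0n -has_count; apply/hasP; exists j.
Qed.

Lemma divisors_finite (m : {cmonom nat}) :
  finite_set [set p : {cmonom nat} * {cmonom nat} | mmul p.1 p.2 = m].
Proof.
set D := [set d : {cmonom nat} | forall i, (d i <= m i)%N].
have finD : finite_set D.
  pose g (d : {cmonom nat}) := [seq d i | i <- finsupp m].
  have inj_g : {in D &, injective g}.
    move=> d d' /set_mem Dd /set_mem Dd' eqg; apply/eqP/cmP => i.
    have [im|] := boolP (i \in finsupp m).
      by have /eq_in_map := eqg; apply.
    rewrite -cmE_eq0 => /eqP mi0.
    by have := Dd i; have := Dd' i; rewrite mi0 !leqn0 => /eqP -> /eqP ->.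
  rewrite -(eq_finite_set (inj_card_eq inj_g)).
  apply: sub_finite_set
    (bounded_seqs_finite (size (finsupp m)) (finite_nat_le (mdeg m))).
  move=> _ [d Dd <-]; split; first by rewrite size_map.
  move=> _ /mapP[i im ->] /=; apply: (leq_trans (Dd i)).
  by rewrite mdegE (big_fsetD1 i) //= leq_addr.
apply: (sub_finite_set _ (finite_setX finD finD)) => -[d d'] /= dm.
by split => i /=; rewrite -dm cmM ?leq_addr ?leq_addl.
Qed.

Section Graph.

Variables (V : finType) (e : rel V).

Definition is_tree : Prop :=
  [/\ symmetric e, irreflexive e, (0 < #|V|)%N,
      forall x y, connect e x y
    & forall p : seq V, (2 < size p)%N -> ~ ucycle e p].

Definition proper_colorings : set {ffun V -> nat} :=
  [set kappa | forall u v, e u v -> kappa u != kappa v].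

Definition chromatic : powser :=
  monom_sum proper_colorings
            (fun kappa => \big[mmul/mone]_(v : V) ucm (kappa v)).

Lemma colorings_fiber_finite (m : {cmonom nat}) :
  finite_set [set kappa | proper_colorings kappa
    /\ \big[mmul/mone]_(v : V) ucm (kappa v) = m].
Proof.
pose g (kappa : {ffun V -> nat}) : seq nat := fgraph kappa.
have inj_g : injective g by move=> f f' /val_inj; apply: (can_inj (@fgraphK _ _)).
apply: sub_finite_set (finite_preimage (in2W inj_g)
  (bounded_seqs_finite #|V| (finite_fset (finsupp m)))).
move=> kappa [_ km]; split; first by rewrite /= size_tuple.
move=> i; rewrite /g -codom_ffun => /codomP[v ->] /=.
rewrite -cmE_neq0 -km mmul_big_ucm -lt0n -has_count; apply/hasP.
by exists v; rewrite ?mem_index_enum.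
Qed.

Definition connected_block (B : {set V}) : bool :=
  [forall x in B, forall y in B,
     connect [rel u v | [&& u \in B, v \in B & e u v]] x y].

Definition connected_partition (P : {set {set V}}) : bool :=
  finset.partition P [set: V]%SET && [forall B in P, connected_block B].

Definition num_connected_partitions (mu : intpart) : nat :=
  #|[pred P : {set {set V}} |
      connected_partition P && perm_eq [seq #|B| | B : {set V} in P] mu]|.

End Graph.

(* Main.v *)
Require Import Defs.
From HB Require Import structures.
From mathcomp Require Import all_boot all_order all_algebra.
From mathcomp Require Import finmap monalg.
From mathcomp Require Import ring zify.
From mathcomp Require Import boolp classical_sets cardinality fsbigop.

Set Implicit Arguments.
Unset Strict Implicit.
Unset Printing Implicit Defensive.

Import Order.TTheory GRing.Theory Num.Theory.

(** The right-hand side of the inequality is a coefficient in disguise. If [T]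
    is a tree on [n] vertices, then the coefficient of [e_la] in [X_T] is
      [c_la = \sum_mu (-1)^(l(la) - l(mu)) b_mu w(B_{la,mu})],
    summed over the partitions [mu] of [n]. Only partitions [mu] refined by
    [la] contribute, and among these [la] is the only one with as many parts as
    [la]; it contributes [b_la] times the product of the parts of [la]. Hence
    [0 <= c_la] says that [b_la] is at least the quotient in the statement, and
    the ceiling is harmless because [b_la] is an integer.

    The formula for [c_la] combines two expansions. The first one is
      [X_T = \sum_P (-1)^(n - |P|) \prod_(B in P) p_|B|],
    over the connected partitions [P] of [T] ([proper_colorings_rooted]). After
    a root is chosen, every vertex other than the root stands for the edge to
    its parent, and a coloring is proper when it satisfies one condition per
    such vertex. Expanding the product of these conditions gives a sum over the
    sets of edges, and in a tree these correspond to the connected partitions.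
    The second one expands products of power sums: solving Newton's identities
    for [p_k] gives a sum over the compositions of [k], that is, over the ways
    of cutting a row of length [k] into bricks, with the length of the last
    brick as a weight ([prod_powersum_tabloids]).

    Both expansions are identities between polynomials in finitely many
    variables, over any commutative ring. A coefficient of a power series
    involves only the finitely many variables of its monomial, so it can be
    read off after all the others have been set to zero ([truncates_mul]).

    Finally, e-positivity is about some expansion in the [e_la], so the
    expansion has to be unique ([e_expansion_unique]). This follows from a
    triangularity with respect to the dominance order of the conjugate
    partitions. *)

(** * Rooting a tree *)

Section RootedTree.

Variables (V : finType) (e : rel V).

(** The last clause makes every edge the parent edge of one of its ends, so that
    the vertices other than [r] can serve as names for the edges. *)
Definition rooting (r : V) (par : V -> V) (depth : V -> nat) : Prop :=
  [/\ forall v, v != r -> e v (par v),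
      forall v, v != r -> depth (par v) < depth v
    & forall x y, e x y -> (x != r /\ y = par x) \/ (y != r /\ x = par y)].

(** In a connected graph, sending each vertex to a neighbour closer to [r]
    (in the graph distance) gives a spanning tree. *)
Lemma closer_neighbour (r : V) :
  symmetric e -> (forall v, connect e r v) ->
  exists par depth, forall v, v != r -> e v (par v) /\ depth (par v) < depth v.
Proof.
move=> sym conn.
have reach v : exists k, [exists p : k.-tuple V, path e r p && (last r p == v)].
  have /connectP[p ep ->] := conn v.
  by exists (size p); apply/existsP; exists (in_tuple p); rewrite /= ep eqxx.
pose depth v := ex_minn (reach v).
have step v : v != r -> exists w, e v w /\ depth w < depth v.
  (* The neighbour is the last but one vertex of a shortest path from [r]. *)
  move=> vr; rewrite {2}/depth.
  case: ex_minnP => k /existsP[p /andP[ep /eqP lp]] _.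
  case: (lastP p) (size_tuple p) ep lp => [|q x] szq ep lp.
    by rewrite -lp eqxx in vr.
  move: ep lp szq; rewrite rcons_path last_rcons size_rcons.
  move=> /andP[eq ex] xv szk.
  exists (last r q); split; first by rewrite sym -xv.
  rewrite /depth; case: ex_minnP => j _ jmin; rewrite -szk ltnS; apply: jmin.
  by apply/existsP; exists (in_tuple q); rewrite /= eq eqxx.
have /choice[par parP] :
    forall v, exists w, v != r -> e v w /\ depth w < depth v.
  move=> v; case: (eqVneq v r) => [->|/step[w ?]]; last by exists w.
  by exists r.
by exists par, depth.
Qed.

(** An edge outside the spanning tree would close a cycle: climbing to the root
    from both of its ends gives a walk between them that avoids it. *)
Lemma tree_rooting : is_tree e -> exists r par depth, rooting r par depth.
Proof.
case=> sym irr /card_gt0P[r _] conn acyc; exists r.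
have [par [depth parP]] := closer_neighbour sym (conn r).
exists par, depth; split=> [v /parP[]//|v /parP[]//|x y exy].
have [/andP[xr /eqP ->]|nx] := boolP ((x != r) && (y == par x)); first by left.
have [/andP[yr /eqP ->]|ny] := boolP ((y != r) && (x == par y)); first by right.
exfalso.
pose e' := [rel u v | e u v && ((u, v) != (x, y)) && ((u, v) != (y, x))].
have sym' : symmetric e'.
  move=> u v; rewrite /= sym -!andbA !xpair_eqE; congr (_ && _).
  by rewrite andbC (andbC (v == y)) (andbC (v == x)).
have climb v : connect e' v r.
  have [k] := ubnP (depth v); elim: k v => // k IHk v; rewrite ltnS => vk.
  have [->//|vr] := eqVneq v r.
  have [ev dv] := parP v vr.
  apply: connect_trans (connect1 _) (IHk (par v) (leq_trans dv vk)).
  rewrite /= ev !xpair_eqE.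
  apply/andP; split; apply/negP => /andP[/eqP vx /eqP vy].
    by rewrite -vx vr vy eqxx in nx.
  by rewrite -vx vr vy eqxx in ny.
have /connectP[p] : connect e' x y.
  by apply: connect_trans (climb x) _; rewrite (sym_connect_sym sym').
(* Without repetitions, such a walk closed up by the edge is a cycle. *)
move=> ep; case/shortenP: ep => q eq uq _ lq.
apply: (acyc (x :: q)).
  case: q eq uq lq => [|u [|? ?]] //= eq uq lq.
    by rewrite -lq irr in exy.
  by move: eq; rewrite lq eqxx andbF.
rewrite /ucycle uq andbT /= rcons_path -lq sym exy andbT.
by apply: sub_path eq => u v /andP[/andP[]].
Qed.

End RootedTree.

(** * Connected partitions of a rooted tree *)

Section TreePartitions.

Variables (V : finType) (e : rel V) (r : V) (par : V -> V) (depth : V -> nat).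
Hypothesis symE : symmetric e.
Hypothesis rootE : rooting e r par depth.

Implicit Types (S : {set V}) (v : V) (P : {set {set V}}).

(** A set [S] of vertices other than [r] stands for the edges from its members
    to their parents. Climbing along these edges from [v] stops after at most
    [depth v] steps, at the highest vertex of the connected component of [v]. *)
Definition climb S v := if v \in S then par v else v.

Definition top S v := iter (depth v) (climb S) v.

Definition tops_partition S := finset.preim_partition (top S) [set: V]%SET.

Definition parented P : {set V} :=
  [set v | (v != r) && (par v \in finset.pblock P v)]%SET.

Let neq_root S v : r \notin S -> v \in S -> v != r.
Proof. by move=> rS vS; apply: contraNneq rS => <-. Qed.

Lemma iter_climb_fix S k v : v \notin S -> iter k (climb S) v = v.
Proof. by move=> vS; elim: k => //= k ->; rewrite /climb (negPf vS). Qed.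

Lemma iter_climb_notin S k v :
  r \notin S -> depth v <= k -> iter k (climb S) v \notin S.
Proof.
case: rootE => _ dpar _ rS.
elim: k v => [|k IHk] v dk.
  apply/negP => /(neq_root rS)/dpar.
  by move: dk; rewrite leqn0 => /eqP ->.
rewrite iterSr; have [vS|vS] := boolP (v \in S); last first.
  by rewrite [climb _ _]/climb (negPf vS) iter_climb_fix.
apply: IHk; rewrite /climb vS -ltnS.
by apply: leq_trans (dpar v (neq_root rS vS)) dk.
Qed.

Lemma top_notin S v : r \notin S -> top S v \notin S.
Proof. by move=> rS; apply: iter_climb_notin. Qed.

Lemma top_id S v : v \notin S -> top S v = v.
Proof. exact: iter_climb_fix. Qed.

(** The climb from [v] goes on as the climb from its parent, and the steps made
    after the top is reached change nothing. *)
Lemma top_par S v : r \notin S -> v \in S -> top S (par v) = top S v.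
Proof.
move=> rS vS; case: rootE => _ dpar _.
have dv := dpar v (neq_root rS vS).
have -> : top S v = iter (depth v).+1 (climb S) v.
  by rewrite iterS -[iter _ _ _]/(top S v) {1}/climb (negPf (top_notin v rS)).
rewrite iterSr {2}/climb vS /top -(subnK (ltnW dv)) iterD.
by rewrite [RHS]iter_climb_fix // iter_climb_notin.
Qed.

Lemma mem_tops_partition S B :
  B \in tops_partition S <-> exists v, B = [set u | top S v == top S u]%SET.
Proof.
rewrite /tops_partition /finset.preim_partition /finset.equivalence_partition.
split=> [/imsetP[v _ ->]|[v ->]].
  by exists v; apply/setP => u; rewrite !inE.
by apply/imsetP; exists v; rewrite ?inE //; apply/setP => u; rewrite !inE.
Qed.

Lemma mem_pblock_tops S u v :
  (u \in finset.pblock (tops_partition S) v) = (top S v == top S u).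
Proof.
rewrite finset.pblock_equivalence_partition ?inE // => x y z _ _ _.
by split=> //= /eqP ->.
Qed.

(** Each block is connected through its top, which every vertex of the block
    reaches by climbing inside it. *)
Lemma tops_partition_connected S :
  r \notin S -> connected_partition e (tops_partition S).
Proof.
move=> rS; rewrite /connected_partition finset.preim_partitionP /=.
apply/forall_inP => B /mem_tops_partition[t ->].
set C := (X in connected_block e X).
rewrite /connected_block; set eC := (X in connect X).
have symC : symmetric eC by move=> u v; rewrite /eC /= symE andbCA.
have [epar dpar _] := rootE.
have toC v : v \in C -> connect eC v (top S v).
  have [k] := ubnP (depth v); elim: k v => // k IHk v; rewrite ltnS => vk vC.
  have [vS|/top_id -> //] := boolP (v \in S).
  have vr := neq_root rS vS.
  have pC : par v \in C by move: vC; rewrite /C !inE top_par.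
  rewrite -top_par //; apply: connect_trans (connect1 _) (IHk _ _ pC).
    by rewrite /eC /= vC pC epar.
  exact: leq_trans (dpar v vr) vk.
apply/forall_inP => x xC; apply/forall_inP => y yC.
apply: connect_trans (toC x xC) _; rewrite (sym_connect_sym symC).
have -> : top S x = top S y by move: xC yC; rewrite /C !inE => /eqP <- /eqP.
exact: toC.
Qed.

(** A vertex outside [S] is its own top, and its parent lies strictly higher,
    so the two are in different blocks. *)
Lemma tops_partitionK S : r \notin S -> parented (tops_partition S) = S.
Proof.
move=> rS; apply/setP => v; rewrite inE mem_pblock_tops.
have [vS|vS] := boolP (v \in S).
  by rewrite top_par // eqxx (neq_root rS vS).
apply/negP => /andP[vr /eqP]; rewrite top_id // => vtop.
have [_ dpar _] := rootE.
have climb_le k u : depth (iter k (climb S) u) <= depth u.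
  elim: k => //= k; apply: leq_trans; rewrite /climb; case: ifP => // uS.
  exact: ltnW (dpar _ (neq_root rS uS)).
have := dpar v vr; rewrite ltnNge => /negP; apply.
by rewrite {1}vtop climb_le.
Qed.

Lemma root_notin_parented P : r \notin parented P.
Proof. by rewrite inE eqxx. Qed.

Lemma mem_connected_partition P B :
  connected_partition e P -> B \in P -> connected_block e B.
Proof. by case/andP => _ /forall_inP; apply. Qed.

(** An edge inside a block joins a vertex to its parent, so its ends have the
    same top; by connectedness the whole block has a single top. *)
Lemma parentedK P : connected_partition e P -> tops_partition (parented P) = P.
Proof.
move=> cP; have /andP[parP _] := cP; have /and3P[/eqP covP triP P0] := parP.
set S := parented P; have rS : r \notin S := root_notin_parented P.
have [_ dpar edge] := rootE.
have cov v : v \in finset.cover P by rewrite covP inE.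
have top_block v : top S v \in finset.pblock P v.
  rewrite /top; elim: (depth v) => [|k IHk] /=.
    by rewrite finset.mem_pblock.
  set w := iter k _ _ in IHk *; rewrite /climb; case: ifP => // wS.
  by move: wS; rewrite inE => /andP[_]; rewrite (finset.same_pblock triP IHk).
have block_top u v : u \in finset.pblock P v -> top S v = top S u.
  set B := finset.pblock P v => uB.
  have BP : B \in P := finset.pblock_mem (cov v).
  have inS a b :
      a \in B -> b \in B -> a != r -> b = par a -> top S a = top S b.
    move=> aB bB ar eqb; rewrite eqb top_par // inE ar -eqb.
    by rewrite (finset.def_pblock triP BP aB).
  have vB : v \in B by rewrite finset.mem_pblock.
  have /forall_inP/(_ v vB)/forall_inP/(_ u uB) :=
    mem_connected_partition cP BP.
  case/connectP => p ep ->; clearbody B.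
  elim: p v {vB} ep => //= y p IHp x /andP[/and3P[xB yB exy] /IHp <-].
  case: (edge x y exy) => -[nr eq]; first exact: inS eq.
  by apply/esym; apply: inS eq.
apply/setP => B; apply/idP/idP.
  case/mem_tops_partition => v ->.
  suff -> : [set u | top S v == top S u]%SET = finset.pblock P v.
    exact: finset.pblock_mem.
  apply/setP => u; rewrite inE; apply/eqP/idP => [eqt|/block_top //].
  rewrite -finset.eq_pblock // -(finset.same_pblock triP (top_block v)) eqt.
  by rewrite (finset.same_pblock triP (top_block u)).
move=> BP; have /set0Pn[v vB] : B != finset.set0 by apply: contraNneq P0 => <-.
apply/mem_tops_partition; exists v; rewrite -(finset.def_pblock triP BP vB).
apply/setP => u; rewrite inE; apply/idP/eqP => [/block_top //|eqt].
rewrite -finset.eq_pblock // -(finset.same_pblock triP (top_block v)) eqt.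
by rewrite (finset.same_pblock triP (top_block u)).
Qed.

Lemma tops_partitionE S : r \notin S ->
  tops_partition S = [set [set v | top S v == t] | t in ~: S]%SET.
Proof.
move=> rS; apply/setP => B; apply/idP/imsetP.
  case/mem_tops_partition => v ->; exists (top S v).
    by rewrite inE top_notin.
  by apply/setP => u; rewrite !inE eq_sym.
case=> t; rewrite inE => tS ->; apply/mem_tops_partition; exists t.
by apply/setP => u; rewrite !inE (top_id tS) eq_sym.
Qed.

Lemma top_fiber_inj S :
  {in (~: S)%SET &, injective (fun t => [set v | top S v == t]%SET)}.
Proof.
move=> t t'; rewrite !inE => tS t'S /setP/(_ t); rewrite !inE (top_id tS) eqxx.
by move/esym/eqP.
Qed.

Lemma card_tops_partition S : r \notin S -> #|tops_partition S| = #|V| - #|S|.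
Proof.
move=> rS; rewrite tops_partitionE // card_in_imset; last exact: top_fiber_inj.
by rewrite cardsCs finset.setCK.
Qed.

Local Open Scope ring_scope.

(** A connected partition is determined by the tree edges inside its blocks, and
    any set [S] of tree edges arises from one. Each block contains exactly one
    vertex that is not in [S], its top; hence [#|P| = #|V| - #|S|]. *)
Lemma sum_connected_partitions (R : comNzRingType) (q : nat -> R) :
  \sum_(P | connected_partition e P)
     (-1) ^+ (#|V| - #|P|) * \prod_(B in P) q #|B|
  = \sum_(S : {set V} | r \notin S)
      (-1) ^+ #|S| * \prod_(t in ~: S) q #|[set v | top S v == t]%SET|.
Proof.
rewrite (reindex_onto tops_partition parented) /=; last exact: parentedK.
apply: eq_big => [S|S /andP[_ /eqP <-]].
  apply/andP/idP => [[_ /eqP <-]|rS]; first exact: root_notin_parented.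
  by rewrite tops_partition_connected // tops_partitionK.
have rS := root_notin_parented (tops_partition S).
set S' := parented _ in rS *.
rewrite card_tops_partition // subKn ?max_card //; congr (_ * _).
by rewrite tops_partitionE // big_imset //=; exact: top_fiber_inj.
Qed.

(** Once the colors of the tops are chosen freely, the colorings that do not
    change along the recorded edges are determined. *)
Lemma sum_block_colorings (R : comNzRingType) (N : nat) (x : 'I_N.+1 -> R)
    (S : {set V}) : r \notin S ->
  \sum_(kappa : {ffun V -> 'I_N.+1} |
        [forall v in S, kappa v == kappa (par v)])
     \prod_v x (kappa v)
  = \prod_(t in ~: S) \sum_i x i ^+ #|[set v | top S v == t]%SET|.
Proof.
move=> rS.
rewrite (big_distr_big ord0) /=.
pose up (g : {ffun V -> 'I_N.+1}) := [ffun v => g (top S v)].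
(* The finite functions on the tops are encoded with the value [ord0] on [S]. *)
pose down (k : {ffun V -> 'I_N.+1}) :=
  [ffun v => if v \in S then ord0 else k v].
rewrite (reindex_onto up down) /=; last first.
  move=> k /forall_inP kS; apply/ffunP => v; rewrite !ffunE.
  rewrite (negPf (top_notin v rS)).
  have kclimb u : k (climb S u) = k u.
    by rewrite /climb; case: ifP => // /kS/eqP.
  by rewrite /top; elim: (depth v) => //= m <-.
apply: eq_big => [g|g _].
  apply/andP/pffun_onP => [[_ /eqP <-]|[gS _]].
    split=> [|i //].
    by apply/supportP => v; rewrite inE negbK ffunE => ->.
  split; first by apply/forall_inP => v vS; rewrite !ffunE top_par.
  apply/eqP/ffunP => v; rewrite !ffunE; case: ifP => vS.
    by move/supportP: gS => ->; rewrite // inE vS.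
  by rewrite top_id // vS.
under eq_bigr do rewrite ffunE.
rewrite (partition_big (top S) (fun t => t \in ~: S)%SET) /=; last first.
  by move=> v _; rewrite inE top_notin.
apply: eq_bigr => t tS.
under eq_bigr => v /eqP -> do [].
by rewrite prodr_const; congr (_ ^+ _); apply: eq_card => v; rewrite !inE.
Qed.

(** Expand the product of the conditions that the edges are not monochromatic,
    one factor for each non-root vertex and its parent. *)
Lemma proper_colorings_rooted (R : comNzRingType) (N : nat) (x : 'I_N.+1 -> R) :
  \sum_(kappa : {ffun V -> 'I_N.+1} |
        [forall u, forall v, e u v ==> (kappa u != kappa v)])
     \prod_v x (kappa v)
  = \sum_(P | connected_partition e P)
      (-1) ^+ (#|V| - #|P|) * \prod_(B in P) \sum_i x i ^+ #|B|.
Proof.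
rewrite (sum_connected_partitions (fun k => \sum_i x i ^+ k)).
have [epar dpar edge] := rootE.
transitivity (\sum_(S : {set V} | r \notin S) (-1) ^+ #|S| *
  \sum_(kappa : {ffun V -> 'I_N.+1} |
        [forall v in S, kappa v == kappa (par v)])
     \prod_v x (kappa v)); last first.
  by apply: eq_bigr => S rS; rewrite sum_block_colorings.
under [RHS]eq_bigr do rewrite mulr_sumr big_mkcond.
rewrite exchange_big big_mkcond /=; apply: eq_bigr => k _.
(* The root gets the factor 1, so that the product runs over all vertices. *)
transitivity (
   (\prod_(v : V) (- (if v == r then 0 else (k v == k (par v))%:R) + 1))
   * \prod_v x (k v)).
  case: ifPn => [/forallP proper|].
    rewrite [X in X * _]big1 ?mul1r // => v _.
    case: eqVneq => [|vr]; first by rewrite oppr0 add0r.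
    have /forallP/(_ (par v))/implyP/(_ (epar v vr)) := proper v.
    by move=> /negPf ->; rewrite oppr0 add0r.
  case/forallPn => u /forallPn[v]; rewrite negb_imply negbK => /andP[euv kuv].
  have [w wr kw] : exists2 w, w != r & k w == k (par w).
    by case: (edge u v euv) => -[wr eq]; [exists u | exists v];
      rewrite // -eq // eq_sym.
  by rewrite [X in X * _](bigD1 w) //= (negPf wr) kw addNr !mul0r.
rewrite bigA_distr /= mulr_suml [RHS]big_mkcond /=.
apply: eq_bigr => S _.
case: ifPn => [rS|]; last first.
  by rewrite negbK => rS; rewrite (bigD1 r) //= rS eqxx oppr0 !mul0r.
rewrite -big_mkcond /=.
case: ifPn => [/forall_inP kS|/forall_inPn[v vS /negPf kv]].
  rewrite (eq_bigr (fun=> -1)) ?prodr_const // => v vS.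
  by rewrite (negPf (neq_root rS vS)) kS.
by rewrite (bigD1 v) //= (negPf (neq_root rS vS)) kv oppr0 !mul0r.
Qed.

End TreePartitions.

(** * Newton's identities *)

Lemma deriv_prod (R : comNzRingType) (I : finType) (F : I -> {poly R}) :
  ((\prod_i F i)^`() = \sum_i (F i)^`() * \prod_(j | j != i) F j)%R.
Proof.
rewrite /index_enum; case: index_enum_key => /=; rewrite -enumT.
elim: (enum I) (enum_uniq I) => [|i s IHs] /=.
  by rewrite !big_nil derivC.
case/andP => iNs /IHs{}IHs; rewrite !big_cons derivM IHs eqxx /=.
congr (_ * _ + _)%R.
  rewrite [RHS]big_seq_cond [LHS]big_seq; apply: eq_bigl => j.
  by case js: (j \in s) => //=; apply/esym; apply: contraNneq iNs => <-.
rewrite mulr_sumr; apply: eq_big_seq => j js; rewrite big_cons.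
have -> : i != j by apply: contraNneq iNs => ->.
exact: mulrCA.
Qed.

Section Newton.

Variables (R : comNzRingType) (I : finType) (x : I -> R).

Local Open Scope ring_scope.

Definition elementary (k : nat) : R :=
  \sum_(J : {set I} | #|J| == k) \prod_(j in J) x j.

Definition powersum (k : nat) : R := \sum_i x i ^+ k.

Let E : {poly R} := \prod_i (x i *: 'X + 1).

Lemma coef_elementary k : E`_k = elementary k.
Proof.
rewrite /E bigA_distr coef_sum /elementary [RHS]big_mkcond /=.
apply: eq_bigr => J _; rewrite -big_mkcond /=.
rewrite scaler_prod prodr_const coefZ coefXn eq_sym.
by case: ifP => _; rewrite ?mulr1 ?mulr0.
Qed.

Let H i : {poly R} := \prod_(j | j != i) (x j *: 'X + 1).

(** Restoring the factor [x i *: 'X + 1] gives a first-order recursion for the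
    coefficients of [H i]. *)
Lemma coef_omit_factor i k :
  (H i)`_k = \sum_(j < k.+1) (-1) ^+ j * x i ^+ j * elementary (k - j).
Proof.
have EH : E = (x i *: 'X + 1) * H i by rewrite /E (bigD1 i).
have Hk n : (H i)`_n.+1 = elementary n.+1 - x i * (H i)`_n.
  rewrite -coef_elementary EH mulrDl mul1r coefD -scalerAl coefZ coefXM /=.
  by rewrite addrAC subrr add0r.
elim: k => [|k IHk].
  rewrite big_ord1 !expr0 !mul1r -coef_elementary EH mulrDl mul1r coefD.
  by rewrite -scalerAl coefZ coefXM /= mulr0 add0r.
rewrite Hk IHk [RHS]big_ord_recl !expr0 !mul1r subn0; congr (_ + _).
rewrite mulr_sumr -sumrN; apply: eq_bigr => j _.
by rewrite /= /bump /= add1n subSS !exprS; ring.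
Qed.

(** Newton's identities: compare the coefficients of the derivative of
    [\prod_i (1 + x_i 'X)] computed termwise and by the product rule. *)
Lemma newton_identity k :
  elementary k.+1 *+ k.+1
  = \sum_(j < k.+1) (-1) ^+ j * powersum j.+1 * elementary (k - j).
Proof.
have dE : E^`() = \sum_i x i *: H i.
  rewrite /E deriv_prod; apply: eq_bigr => i _.
  by rewrite derivD derivZ derivX derivC addr0 -scalerAl mul1r.
rewrite -coef_elementary -coef_deriv dE coef_sum.
under eq_bigr do rewrite coefZ coef_omit_factor mulr_sumr.
rewrite exchange_big /=; apply: eq_bigr => j _.
rewrite -mulrA [powersum _ * _]mulr_suml mulr_sumr; apply: eq_bigr => i _.
by rewrite exprS; ring.
Qed.

(** Newton's identity for [k.+1], solved for [powersum k.+1], with the summation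
    index counting from the other end. *)
Lemma powersum_recursion k :
  powersum k.+1 = (-1) ^+ k * (elementary k.+1 *+ k.+1)
    + \sum_(j < k) (-1) ^+ j * elementary j.+1 * powersum (k - j).
Proof.
have e0 : elementary 0 = 1.
  rewrite /elementary (big_pred1 finset.set0) ?big_set0 // => J.
  by rewrite cards_eq0.
rewrite newton_identity (reindex_inj rev_ord_inj) /=.
under eq_bigr => j _ do rewrite subSS subKn -1?ltnS //.
rewrite big_ord_recl /= subn0 e0 mulr1 mulrDr mulrA -expr2 sqrr_sign mul1r.
rewrite -addrA [X in _ + X](_ : _ = 0) ?addr0 // mulr_sumr -big_split /=.
apply: big1 => j _; rewrite /bump /= add1n -subSn ?ltn_ord // subSS.
have {1}-> : k = (j + (k - j))%N by rewrite subnKC // ltnW.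
have -> : (k - j)%N = (k - j.+1).+1 by rewrite subnSK.
rewrite exprD !exprS; set a := (-1) ^+ (k - _); set b := (-1) ^+ j.
have aa : a * a = 1 by rewrite -expr2 sqrr_sign.
by ring: aa.
Qed.

End Newton.

(** * Brick tabloids as lists *)

(** The fuel bounds the number of parts; [k] is always enough, as the parts are
    positive. *)
Fixpoint compositions_fuel (fuel k : nat) : seq (seq nat) :=
  if k == 0 then [:: [::]] else
  if fuel is fuel'.+1 then
    [seq i :: c | i <- iota 1 k, c <- compositions_fuel fuel' (k - i)]
  else [::].

Definition compositions k := compositions_fuel k k.

Lemma compositions_fuelS fuel k : compositions_fuel fuel.+1 k.+1 =
  [seq i :: c | i <- iota 1 k.+1, c <- compositions_fuel fuel (k.+1 - i)].
Proof. by []. Qed.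

Lemma mem_compositions_fuel fuel k c : k <= fuel ->
  (c \in compositions_fuel fuel k) = (sumn c == k) && (0 \notin c).
Proof.
elim: fuel k c => [|fuel IH] [|k] c // kf.
- by case: c => [|[|i] c] //=; rewrite !inE ?andbF.
- by case: c => [|[|i] c] //=; rewrite !inE ?andbF.
rewrite compositions_fuelS.
apply/allpairsPdep/andP => [[i [d [ik dk ->]]]|[/eqP sc c0]].
  move: ik; rewrite mem_iota => /andP[i0 ik].
  move: dk; rewrite IH; last first.
    by rewrite leq_subLR (leq_trans kf) // -add1n leq_add2r.
  case/andP=> /eqP sd d0; rewrite /= sd subnKC //; split=> //.
  by rewrite inE negb_or d0 andbT neq_ltn i0.
case: c sc c0 => [|i c] // sc.
rewrite inE negb_or eq_sym -lt0n => /andP[i0 c0].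
rewrite [sumn _]/= in sc.
have ik : i <= k.+1 by rewrite -sc leq_addr.
exists i, c; rewrite mem_iota i0 add1n ltnS; split=> //.
rewrite IH; first by rewrite c0 -sc addKn eqxx.
by rewrite leq_subLR (leq_trans kf) // -add1n leq_add2r.
Qed.

Lemma mem_compositions k c :
  (c \in compositions k) = (sumn c == k) && (0 \notin c).
Proof. exact: mem_compositions_fuel. Qed.

Lemma uniq_compositions k : uniq (compositions k).
Proof.
rewrite /compositions; move: {1}k => fuel; elim: fuel k => [|fuel IH] [|j] //.
rewrite compositions_fuelS.
apply: allpairs_uniq_dep => [|i _|[i c] [j' d] _ _ /= [-> ->]] //.
exact: iota_uniq.
Qed.

Fixpoint tabloids (s : seq nat) : seq (seq (seq nat)) :=
  if s is k :: s' then [seq c :: t | c <- compositions k, t <- tabloids s']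
  else [:: [::]].

Lemma mem_tabloids s t :
  (t \in tabloids s) = ([seq sumn r | r <- t] == s) && (0 \notin flatten t).
Proof.
elim: s t => [|k s IH] [|c t] //=.
  by apply/allpairsP => -[[? ?] []].
rewrite eqseq_cons mem_cat negb_or andbACA -IH -mem_compositions.
by apply/allpairsP/andP => [[[? ?] [/= ? ? [-> ->]]]|[? ?]]; last exists (c, t).
Qed.

Lemma uniq_tabloids s : uniq (tabloids s).
Proof.
elim: s => //= k s IH; apply: allpairs_uniq => //.
  exact: uniq_compositions.
by move=> [? ?] [? ?] _ _ [-> ->].
Qed.

(** * Power sums in terms of elementary symmetric functions *)

Section PowerSums.

Variables (R : comNzRingType) (I : finType) (x : I -> R).

Local Open Scope ring_scope.

(** Iterating the recursion splits off the bricks of a row one at a time; the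
    iteration stops with the last brick, which contributes its length. *)
Lemma powersum_compositions_fuel fuel k : (k <= fuel)%N -> (0 < k)%N ->
  powersum x k = \sum_(c <- compositions_fuel fuel k)
    (-1) ^+ (k + size c) * (last 0 c)%:R * \prod_(i <- c) elementary x i.
Proof.
elim: fuel k => [|fuel IH] [|k] //; rewrite ltnS => kf _.
rewrite compositions_fuelS big_allpairs_dep (iotaDl 1 0) big_map.
rewrite -[iota _ _]/(index_iota 0 k.+1) big_mkord big_ord_recr.
rewrite powersum_recursion [LHS]addrC /=; congr (_ + _).
  apply: eq_bigr => j _; rewrite add1n subSS.
  rewrite IH ?subn_gt0 //; last by rewrite (leq_trans (leq_subr _ _)).
  rewrite mulr_sumr big_seq [RHS]big_seq; apply: eq_bigr => c.
  rewrite mem_compositions_fuel; last by rewrite (leq_trans (leq_subr _ _)).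
  case/andP => /eqP sc _; rewrite big_cons /=.
  (* The rest of the row is nonempty, so the first brick is not the last. *)
  have -> : last j.+1 c = last 0%N c.
    by case: c sc => //= /eqP; rewrite eq_sym subn_eq0 leqNgt ltn_ord.
  have -> : (k.+1 + (size c).+1 = j + (k - j + size c) + 2)%N.
    by rewrite addnA subnKC ?(ltnW (ltn_ord j)) // addSn addnS addn2.
  by rewrite !exprD sqrrN expr1n mulr1; ring.
have -> : compositions_fuel fuel (k.+1 - (1 + k)) = [:: [::]].
  by rewrite add1n subnn; case: (fuel).
by rewrite big_seq1 big_seq1 /= addn1 !exprS -mulr_natl; ring.
Qed.

Lemma powersum_compositions k : (0 < k)%N ->
  powersum x k = \sum_(c <- compositions k)
    (-1) ^+ (k + size c) * (last 0 c)%:R * \prod_(i <- c) elementary x i.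
Proof. exact: powersum_compositions_fuel. Qed.

(** A tabloid is an independent choice of a composition for each row. *)
Lemma prod_powersum_tabloids s : 0%N \notin s ->
  \prod_(k <- s) powersum x k = \sum_(t <- tabloids s)
    (-1) ^+ (sumn s + size (flatten t)) * (tabloid_weight t)%:R
    * \prod_(i <- flatten t) elementary x i.
Proof.
elim: s => [|k s IH] /=.
  by rewrite big_nil big_seq1 /= /tabloid_weight !big_nil !mulr1.
rewrite inE negb_or eq_sym -lt0n => /andP[k0 s0].
rewrite big_cons IH // powersum_compositions // big_allpairs_dep.
rewrite mulr_suml; apply: eq_bigr => c _.
rewrite mulr_sumr; apply: eq_bigr => t _.
rewrite /= big_cat size_cat /tabloid_weight big_cons natrM addnACA.
rewrite [X in _ = X * _ * _]exprD.
by rewrite /=; ring.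
Qed.

End PowerSums.

(** * Integer partitions and brick weights *)

Section IntegerPartitions.

Implicit Types (la mu : intpart) (s : seq nat).

Lemma intpart_sorted la : sorted geq la.
Proof. by case: la => s /= /andP[]. Qed.

Lemma intpart_pos la : 0 \notin (la : seq nat).
Proof. by case: la => s /= /andP[]. Qed.

Lemma geq_trans : transitive geq.
Proof. by move=> a b c /= ab bc; apply: leq_trans bc ab. Qed.

Lemma perm_intpart la mu : perm_eq la mu -> la = mu.
Proof.
move=> lamu; apply: val_inj.
apply: (sorted_eq geq_trans _ (intpart_sorted la) (intpart_sorted mu) lamu).
by move=> a b /=; rewrite andbC => /anti_leq.
Qed.

Lemma intpart_nil_subproof : is_intpart [::]. Proof. by []. Qed.

(** Meaningful for lists of positive numbers; a list containing 0 is sent to the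
    empty partition. *)
Definition intpart_of s : intpart :=
  insubd (IntPart intpart_nil_subproof) (sort geq s).

Lemma perm_intpart_of s : 0 \notin s -> perm_eq (intpart_of s) s.
Proof.
move=> s0; rewrite /intpart_of /insubd insubT /=; last first.
  by move=> ?; rewrite perm_sort.
apply/andP; split; last by rewrite mem_sort.
by apply: sort_sorted => a b /=; apply: leq_total.
Qed.

Definition intparts n : seq intpart :=
  undup [seq intpart_of c | c <- compositions n].

Lemma mem_intparts n la : (la \in intparts n) = (sumn la == n).
Proof.
rewrite mem_undup; apply/mapP/eqP => [[c]|lan].
  rewrite mem_compositions => /andP[/eqP <- c0] ->.
  exact/perm_sumn/perm_intpart_of.
exists (la : seq nat); first by rewrite mem_compositions lan eqxx intpart_pos.
by apply/perm_intpart; rewrite perm_sym perm_intpart_of ?intpart_pos.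
Qed.

(** Exactly one partition of [n] is a rearrangement of [type i]. *)
Lemma sum_by_type (R : nmodType) (I : eqType) (r : seq I) (P : pred I)
    (type : I -> seq nat) n (F : I -> R) :
  (forall i, i \in r -> P i -> sumn (type i) = n /\ 0 \notin type i) ->
  (\sum_(i <- r | P i) F i
   = \sum_(la <- intparts n) \sum_(i <- r | P i && perm_eq (type i) la) F i)%R.
Proof.
move=> Pn; under [RHS]eq_bigr do rewrite big_mkcondr.
rewrite exchange_big /= big_seq_cond [RHS]big_seq_cond.
apply: eq_bigr => i /andP[ir Pi]; have [sn s0] := Pn i ir Pi.
have la_in : intpart_of (type i) \in intparts n.
  by rewrite mem_intparts (perm_sumn (perm_intpart_of s0)) sn.
rewrite (bigD1_seq _ la_in) ?undup_uniq //= perm_sym perm_intpart_of //.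
rewrite big1 ?addr0 // => la nla; case: ifP => // Pla.
case/eqP: nla; apply: perm_intpart; rewrite perm_sym.
by apply: perm_trans Pla; apply: perm_intpart_of.
Qed.

Lemma brick_weightE la mu :
  brick_weight la mu
  = (\sum_(t <- tabloids mu | perm_eq (flatten t) la) tabloid_weight t)%N.
Proof.
rewrite -big_filter fsbig_seq ?filter_uniq ?uniq_tabloids //; apply: eq_fsbigl.
apply/seteqP; split=> t /=; rewrite mem_filter mem_tabloids.
  by case=> tmu tla; rewrite tla (perm_mem tla) intpart_pos andbT; apply/eqP.
by case/and3P => tla /eqP tmu _.
Qed.

Lemma brick_weight_neq0 la mu : brick_weight la mu != 0 -> refined_by mu la.
Proof.
move=> w0; have [//|nref] := pselect (refined_by mu la).
case/eqP: w0; apply: fsbig1 => t [tmu tla].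
by case: nref; exists t.
Qed.

Lemma refined_by_sumn la mu : refined_by mu la -> sumn mu = sumn la.
Proof. by case=> t <- /perm_sumn <-; rewrite sumn_flatten. Qed.

Lemma leq_size_flatten (t : seq (seq nat)) :
  [::] \notin t -> size t <= size (flatten t).
Proof.
elim: t => //= -[|k r] u IH //; rewrite inE /= => /IH.
by rewrite size_cat; lia.
Qed.

(** Each row holds at least one brick, so no row can hold two. *)
Lemma rows_singletons (t : seq (seq nat)) :
  [::] \notin t -> size (flatten t) <= size t ->
  flatten t = [seq sumn r | r <- t] /\ t = [seq [:: k] | k <- flatten t].
Proof.
elim: t => //= -[|k r] t IH; rewrite inE //= => t0.
rewrite size_cat => szt; have := leq_size_flatten t0.
case: r szt => [|? ?] /= szt; last by lia.
move=> _; have [|flatE tE] := IH t0; first by lia.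
by split; [rewrite addn0 flatE | rewrite -tE].
Qed.

Lemma rows_nonempty (t : seq (seq nat)) mu :
  [seq sumn r | r <- t] = mu -> [::] \notin t.
Proof.
by move=> tmu; apply: contra (intpart_pos mu) => /(map_f sumn); rewrite tmu.
Qed.

Lemma refined_by_size la mu :
  refined_by mu la -> (size mu < size la) || (mu == la).
Proof.
case=> t tmu tla; have t0 := rows_nonempty tmu.
have szt : size t = size mu by rewrite -tmu size_map.
rewrite -(perm_size tla) -szt; case: ltnP => //= /(rows_singletons t0)[tE _].
by apply/eqP/perm_intpart; rewrite -tmu -tE.
Qed.

(** The only tabloid of shape and content [la] has a single brick in each row. *)
Lemma brick_weight_diag la : brick_weight la la = \prod_(k <- la) k.
Proof.
have -> : \prod_(k <- la) k = tabloid_weight [seq [:: k] | k <- la].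
  by rewrite /tabloid_weight big_map.
rewrite /brick_weight -[RHS](@fsbig_set1 _ _ addn _ _ tabloid_weight).
apply: eq_fsbigl.
apply/seteqP; split=> [t [tla ft]|_ ->] /=; last first.
  split; last by rewrite flatten_map1 map_id.
  by rewrite -map_comp (eq_map (g := id)) ?map_id // => k /=; rewrite addn0.
have [|tE ->] := rows_singletons (rows_nonempty tla).
  by rewrite (perm_size ft) -tla size_map.
by rewrite tE tla.
Qed.

End IntegerPartitions.

(** * Setting almost all variables to zero *)

Local Notation monom := {cmonom nat}.
Local Notation polys := {malg rat[{cmonom nat}]}.

Section Truncation.

Local Open Scope classical_set_scope.
Local Open Scope ring_scope.

Implicit Types (N : nat) (m : monom) (f g : powser) (P Q : polys).

Definition below N m : Prop := forall i, (N <= i)%N -> m i = 0%N.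

(** Nothing is asked of the other coefficients of [P]: this is preserved by
    products, because the divisors of a monomial in the first [N] variables only
    involve these variables. *)
Definition truncates N f P : Prop := forall m, below N m -> P@_m = f m.

Lemma below_mmul N m m' : below N (mmul m m') -> below N m /\ below N m'.
Proof.
move=> mN; split=> i /mN; rewrite cmM => /eqP; rewrite addn_eq0.
  by case/andP => /eqP.
by case/andP => _ /eqP.
Qed.

Lemma exists_below m : exists N, below N.+1 m.
Proof.
exists (\max_(i <- finsupp m) i)%N => i; apply: contraTeq.
rewrite cmE_neq0 -leqNgt => im.
exact: (@leq_bigmax_seq _ _ xpredT (fun i => i)).
Qed.

Lemma truncates_one N : truncates N powser_one 1.
Proof. by move=> m _; rewrite mcoeff1. Qed.

Lemma truncates_mul N f g P Q :
  truncates N f P -> truncates N g Q -> truncates N (powser_mul f g) (P * Q).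
Proof.
move=> fP gQ m mN; rewrite mcoeffMl /powser_mul.
pose r := [seq (k1, k2) | k1 <- msupp P, k2 <- msupp Q].
transitivity (\sum_(p <- r | mmul p.1 p.2 == m) P@_p.1 * Q@_p.2).
  rewrite [RHS]big_mkcond /r big_allpairs_dep /=.
  by apply: eq_bigr => k1 _; apply: eq_bigr => k2 _; case: eqP.
rewrite bigfs; first last.
- move=> [k1 k2] _ /=; apply: contraNeq; rewrite mulf_eq0 negb_or !mcoeff_neq0.
  by case/andP => ? ?; apply: allpairs_f.
- by apply: allpairs_uniq; rewrite ?fset_uniq // => -[? ?] [? ?].
have -> : [set` [pred p : monom * monom | mmul p.1 p.2 == m]]
    = [set p | mmul p.1 p.2 = m].
  by apply/seteqP; split=> p /eqP.
apply: eq_fsbigr => -[k1 k2] /set_mem /= km.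
by rewrite -km in mN; case/below_mmul: mN => /fP -> /gQ ->.
Qed.

(** Only the members of the family whose monomial is free of the variables of
    index at least [N] matter; [h] lists them, and possibly others. *)
Lemma truncates_monom_sum N (J : choiceType) (A : set J) (F : J -> monom)
    (T : finType) (B : pred T) (h : T -> J) :
  injective h -> (forall t, B t <-> A (h t)) ->
  (forall j, A j -> below N (F j) -> exists t, h t = j) ->
  truncates N (monom_sum A F) (\sum_(t | B t) << F (h t) >>).
Proof.
move=> injh BA hN m mN; rewrite raddf_sum /= /monom_sum.
under eq_bigr do rewrite mcoeffU1.
have -> : [set j | A j /\ F j = m]
    = h @` [set` [pred t | B t && (F (h t) == m)]].
  apply/seteqP; split=> [j [Aj Fj]|_ [t /andP[Bt /eqP Ft] <-]].
    have [|t htj] := hN j Aj; first by rewrite Fj.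
    by exists t => //=; rewrite !inE htj Fj eqxx andbT; apply/BA; rewrite htj.
  by split=> //; apply/BA.
rewrite fsbig_image; last by move=> t t' _ _; apply: injh.
rewrite -(@bigfs _ _ _ _ (index_enum T)) ?index_enum_uniq //; last first.
  by move=> t _; rewrite mem_index_enum.
by rewrite big_mkcondr; apply: eq_bigr => t _; case: eqP.
Qed.

Lemma malgU_prod (I : Type) (s : seq I) (B : pred I) (F : I -> monom) :
  << \big[mmul/mone]_(i <- s | B i) F i >>
  = \prod_(i <- s | B i) << F i >> :> polys.
Proof.
apply: (big_morph (fun m => << m >> : polys)) => // m m'.
by rewrite malgM_def fgmulUU mulr1.
Qed.

Lemma below_prod (I : eqType) (s : seq I) (F : I -> nat) N :
  below N (\big[mmul/mone]_(i <- s) ucm (F i)) -> {in s, forall i, F i < N}%N.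
Proof.
move=> sN i si; rewrite ltnNge; apply/negP => /sN/eqP.
rewrite (mmul_big_ucm s F) -leqn0 leqNgt -has_count => /negP; apply.
by apply/hasP; exists i.
Qed.

Lemma truncates_elementary N k :
  truncates N (elem_sym k) (elementary (fun i : 'I_N => << ucm (val i) >>) k).
Proof.
pose h (J : {set 'I_N}) : {fset nat} := seq_fset tt (map val (enum J)).
have ph J : perm_eq (h J) (map val (enum J)).
  rewrite -[X in perm_eq _ X]undup_id ?seq_fset_perm //.
  by rewrite map_inj_uniq ?enum_uniq //; apply: val_inj.
pose mon (J : {fset nat}) : monom := \big[mmul/mone]_(j <- J) ucm j.
have -> : elementary (fun i : 'I_N => << ucm (val i) >>) k
    = \sum_(J : {set 'I_N} | #|J| == k) << mon (h J) >> :> polys.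
  apply: eq_bigr => J _; rewrite /mon (perm_big _ (ph J)) big_map big_enum.
  by rewrite malgU_prod.
apply: truncates_monom_sum => [J J' /fsetP eqJ|J|J _ JN].
- apply/setP => i; have := eqJ (val i).
  by rewrite !seq_fsetE !mem_map ?mem_enum //; apply: val_inj.
- rewrite /= -(rwP eqP) (perm_size (ph J)) size_map -cardE.
  by split.
- exists [set i : 'I_N | val i \in J]%SET; apply/fsetP => j.
  rewrite seq_fsetE; apply/mapP/idP => [[i]|jJ].
    by rewrite mem_enum inE => ? ->.
  have jN := below_prod JN jJ.
  by exists (Ordinal jN); rewrite // mem_enum inE.
Qed.

Lemma truncates_elem_sym_part N (la : intpart) :
  truncates N (elem_sym_part la)
    (\prod_(k <- parts la) elementary (fun i : 'I_N => << ucm (val i) >>) k).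
Proof.
rewrite /elem_sym_part; elim: (parts la) => [|k s IH] /=.
  by rewrite big_nil; apply: truncates_one.
by rewrite big_cons; apply: truncates_mul => //; apply: truncates_elementary.
Qed.

Lemma truncates_chromatic N (V : finType) (e : rel V) :
  truncates N (chromatic e)
    (\sum_(kappa : {ffun V -> 'I_N} |
              [forall u, forall v, e u v ==> (kappa u != kappa v)])
       \prod_v << ucm (val (kappa v)) >>).
Proof.
pose h (kappa : {ffun V -> 'I_N}) : {ffun V -> nat} := [ffun v => val (kappa v)].
pose mon (kappa : {ffun V -> nat}) : monom := \big[mmul/mone]_v ucm (kappa v).
under eq_bigr => kappa _.
  rewrite (_ : \prod_v _ = << mon (h kappa) >>); first over.
  by rewrite /mon malgU_prod; apply: eq_bigr => v _; rewrite ffunE.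
apply: truncates_monom_sum => [k k' /ffunP eqk|k|k _ kN].
- by apply/ffunP => v; apply/val_inj; have := eqk v; rewrite !ffunE.
- split=> [/forallP proper u v euv|proper].
    have /forallP/(_ v)/implyP/(_ euv) := proper u.
    by rewrite !ffunE.
  apply/forallP => u; apply/forallP => v; apply/implyP => /proper.
  by rewrite !ffunE.
- have kN' v : (k v < N)%N by apply: (below_prod kN); rewrite mem_index_enum.
  by exists [ffun v => Ordinal (kN' v)]; apply/ffunP => v; rewrite !ffunE.
Qed.

End Truncation.

(** * Linear independence of the elementary basis *)

Section Unique.

Local Open Scope classical_set_scope.
Local Open Scope ring_scope.

Lemma fsumr_neq0 (I : choiceType) (A : set I) (F : I -> rat) :
  \sum_(i \in A) F i != 0 -> exists2 i, A i & F i != 0.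
Proof. exact: (@fsbigN1 _ _ _ unit I A (fun=> F) tt). Qed.

Lemma powser_mul_neq0 (f g : powser) m : powser_mul f g m != 0 ->
  exists m1 m2, [/\ m = mmul m1 m2, f m1 != 0 & g m2 != 0].
Proof.
case/fsumr_neq0 => -[m1 m2] /= <-; rewrite mulf_eq0 negb_or => /andP[? ?].
by exists m1, m2.
Qed.

Definition powser_ge0 (f : powser) : Prop := forall m, 0 <= f m.

Lemma powser_mul_ge0 (f g : powser) :
  powser_ge0 f -> powser_ge0 g -> powser_ge0 (powser_mul f g).
Proof. by move=> f0 g0 m; apply: fsumr_ge0 => p _; apply: mulr_ge0. Qed.

Lemma powser_mul_gt0 (f g : powser) m1 m2 : powser_ge0 f -> powser_ge0 g ->
  0 < f m1 -> 0 < g m2 -> 0 < powser_mul f g (mmul m1 m2).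
Proof.
move=> f0 g0 fm gm; rewrite /powser_mul.
rewrite (fsbigD1 (m1, m2)) //=; last exact: divisors_finite.
rewrite ltr_wpDr ?mulr_gt0 //.
by apply: fsumr_ge0 => p _; apply: mulr_ge0.
Qed.

Lemma elem_sym_ge0 k : powser_ge0 (elem_sym k).
Proof. by move=> m; apply: fsumr_ge0. Qed.

Lemma elem_sym_prod_ge0 (s : seq nat) :
  powser_ge0 (foldr (fun k => powser_mul (elem_sym k)) powser_one s).
Proof.
elim: s => /= [m|k s IH].
  by rewrite /powser_one ler0n.
by apply: powser_mul_ge0 => //; apply: elem_sym_ge0.
Qed.

(** The leading monomial of [e_la]: the factor [e_k] contributes the product of
    the first [k] variables. *)
Definition lead_monom (s : seq nat) : {cmonom nat} :=
  \big[mmul/mone]_(k <- s) \big[mmul/mone]_(j <- iota 0 k) ucm j.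

(** The partial sums of the conjugate partition. *)
Definition conj_sum (s : seq nat) (j : nat) : nat := (\sum_(k <- s) minn k j)%N.

Definition low_degree (m : {cmonom nat}) (j : nat) : nat :=
  (\sum_(i < j) m i)%N.

Lemma low_degree_mul m1 m2 j :
  low_degree (mmul m1 m2) j = (low_degree m1 j + low_degree m2 j)%N.
Proof. by rewrite -big_split; apply: eq_bigr => i _; rewrite cmM. Qed.

Lemma low_degree_squarefree (r : seq nat) j : uniq r ->
  low_degree (\big[mmul/mone]_(i <- r) ucm i) j = count (fun i => i < j)%N r.
Proof.
move=> ur; rewrite /low_degree.
transitivity (\sum_(i < j) (val i \in r : nat))%N.
  apply: eq_bigr => i _; rewrite -(count_uniq_mem _ ur).
  exact: (mmul_big_ucm r id).
rewrite -(big_mkord xpredT (fun i => nat_of_bool (i \in r))) -big_mkcond /=.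
rewrite sum1_count -!size_filter; apply/perm_size/uniq_perm.
- by rewrite filter_uniq // iota_uniq.
- exact: filter_uniq.
by move=> i; rewrite !mem_filter mem_index_iota andbC.
Qed.

(** A monomial of [e_k] is squarefree of degree [k]. *)
Lemma elem_sym_neq0 k m j : elem_sym k m != 0 -> (low_degree m j <= minn k j)%N.
Proof.
case/fsumr_neq0 => J [<- <-] _; rewrite low_degree_squarefree ?fset_uniq //.
rewrite leq_min count_size -size_filter -[X in (_ <= X)%N](size_iota 0).
apply: uniq_leq_size; first by rewrite filter_uniq ?fset_uniq.
by move=> i; rewrite mem_filter mem_iota add0n => /andP[].
Qed.

(** The bounds for the factors add up. Together they express dominance, since
    the leading monomial attains them ([low_degree_lead_monom]). *)
Lemma elem_sym_part_neq0 (la : intpart) m j :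
  elem_sym_part la m != 0 -> (low_degree m j <= conj_sum la j)%N.
Proof.
rewrite /elem_sym_part /conj_sum; elim: (parts la) m => /= [|k s IH] m.
  rewrite /powser_one; have [->|] := eqVneq m mone; last by rewrite eqxx.
  by rewrite /low_degree big1 // => i _; rewrite cm1.
case/powser_mul_neq0 => m1 [m2 [-> /elem_sym_neq0 k1 /IH s2]].
by rewrite low_degree_mul big_cons leq_add.
Qed.

Lemma low_degree_lead_monom s j : low_degree (lead_monom s) j = conj_sum s j.
Proof.
rewrite /lead_monom /conj_sum; elim: s => [|k s IH].
  by rewrite !big_nil /low_degree big1 // => i _; rewrite cm1.
rewrite !big_cons low_degree_mul IH low_degree_squarefree ?iota_uniq //.
congr (_ + _)%N; rewrite -size_filter; apply/eqP.
rewrite -[X in _ == X](size_iota 0); apply/eqP/perm_size/uniq_perm.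
- by rewrite filter_uniq ?iota_uniq.
- exact: iota_uniq.
by move=> i; rewrite mem_filter !mem_iota !add0n leq_min andbC.
Qed.

(** The coefficients are nonnegative, so the product of the leading monomials of
    the factors is not cancelled. *)
Lemma elem_sym_part_lead (la : intpart) : 0 < elem_sym_part la (lead_monom la).
Proof.
rewrite /elem_sym_part /lead_monom; elim: (parts la) => /= [|k s IH].
  by rewrite big_nil /powser_one eqxx.
rewrite big_cons; apply: powser_mul_gt0 => //.
- exact: elem_sym_ge0.
- exact: elem_sym_prod_ge0.
rewrite /elem_sym /monom_sum; set J := seq_fset tt (iota 0 k).
have pJ : perm_eq J (iota 0 k).
  by rewrite -[X in perm_eq _ X]undup_id ?iota_uniq // seq_fset_perm.
rewrite (fsbigD1 J) /=; first last.
- by split; [rewrite (perm_size pJ) size_iota | apply: perm_big].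
- exact: subsets_fiber_finite.
by rewrite ltr_wpDr // fsumr_ge0.
Qed.

Lemma count_gt_conj_sum s j :
  (conj_sum s j + count (fun k => j < k)%N s = conj_sum s j.+1)%N.
Proof.
rewrite /conj_sum -sum1_count [X in (_ + X)%N]big_mkcond -big_split /=.
by apply: eq_bigr => k _; case: ifP; lia.
Qed.

(** The differences of the partial sums count the parts larger than [j], and the
    differences of these counts are the multiplicities of the parts. *)
Lemma conj_sum_inj (la mu : intpart) : conj_sum la =1 conj_sum mu -> la = mu.
Proof.
move=> eqD.
have eqc j : count (fun k => j < k)%N la = count (fun k => j < k)%N mu.
  apply/eqP; rewrite -(eqn_add2l (conj_sum la j)) {2}eqD.
  by rewrite !count_gt_conj_sum eqD.
have cS (s : seq nat) j :
    (count_mem j.+1 s + count (fun k => j.+1 < k) s = count (fun k => j < k) s)%N.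
  rewrite -(count_predUI (pred1 j.+1)) [X in (_ + X)%N](eq_count (a2 := pred0)).
    rewrite count_pred0 addn0; apply: eq_count => k /=; lia.
  by move=> k /=; lia.
apply: perm_intpart; apply/allP => -[|j] _ /=.
  by rewrite !(count_memPn (intpart_pos _)).
by have := cS la j; have := cS mu j; rewrite -!eqc => <- /addIn ->.
Qed.

Lemma conj_sum_const s B j : {in s, forall k, k <= B}%N -> (B <= j)%N ->
  conj_sum s j = conj_sum s B.
Proof.
move=> sB Bj; rewrite /conj_sum; apply: eq_big_seq => k /sB kB.
by rewrite !(minn_idPl _) // (leq_trans kB).
Qed.

(** Triangularity: in a linear relation, the leading monomial of [e_la] can
    only be cancelled by terms with larger conjugate partial sums. *)
Lemma elem_sym_part_free (r : seq intpart) (d : intpart -> rat) :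
  uniq r -> (forall m, \sum_(la <- r) d la * elem_sym_part la m = 0) ->
  {in r, forall la, d la = 0}.
Proof.
move=> ur rel.
pose B := (\max_(la <- r) \max_(k <- parts la) k)%N.
have leB la : la \in r -> {in parts la, forall k, k <= B}%N.
  move=> lar k kla; apply: leq_trans (@leq_bigmax_seq _ r xpredT _ la lar _) => //.
  exact: (@leq_bigmax_seq _ _ xpredT (fun k => k)).
(* [W] turns the comparison of all partial sums into that of a single number;
   beyond the largest part [B] the partial sums are constant. *)
pose W (la : intpart) := (\sum_(j < B.+1) conj_sum la j)%N.
pose maxW := (\max_(la <- r) W la)%N.
have WmaxW la : la \in r -> (W la <= maxW)%N.
  by move=> lar; apply: (@leq_bigmax_seq _ r xpredT).
have step la : la \in r ->
    (forall mu, mu \in r -> (W la < W mu)%N -> d mu = 0) -> d la = 0.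
  move=> lar dW; have := rel (lead_monom la).
  rewrite (bigD1_seq la) //= big_seq_cond big1 ?addr0 => [/eqP|mu /andP[mur mula]].
    by rewrite mulf_eq0 (gt_eqF (elem_sym_part_lead la)) orbF => /eqP.
  have [->|/elem_sym_part_neq0 dom] :=
    eqVneq (elem_sym_part mu (lead_monom la)) 0; first by rewrite mulr0.
  have [/(dW mu mur) ->|Wle] := ltnP (W la) (W mu); first by rewrite mul0r.
  case/eqP: mula; apply: conj_sum_inj.
  have domj (j : 'I_B.+1) : true ->
      (conj_sum la j <= conj_sum mu j
         ?= iff (conj_sum la j == conj_sum mu j))%N.
    by move=> _; split=> //; rewrite -low_degree_lead_monom.
  have [_ /esym eqW] := leqif_sum domj.
  have {eqW} /forallP eqW :
      [forall j : 'I_B.+1, conj_sum la j == conj_sum mu j].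
    rewrite eqW eqn_leq Wle andbT; apply: leq_sum => j _.
    by rewrite -low_degree_lead_monom.
  move=> j; case: (leqP j B) => jB.
    by have /eqP := eqW (Ordinal (jB : (j < B.+1)%N)).
  rewrite !(@conj_sum_const _ B j) ?(ltnW jB) //; [|exact: leB|exact: leB].
  by have /eqP := eqW ord_max.
move=> la lar; have [k] := ubnP (maxW - W la)%N.
elim: k la lar => // k IH la lar; rewrite ltnS => Wk.
apply: step => // mu mur Wlt; apply: IH => //.
by have := WmaxW mu mur; lia.
Qed.

Lemma e_expansion_unique f (c c' : {fsfun intpart -> rat with 0}) :
  e_expansion f c -> e_expansion f c' -> c =1 c'.
Proof.
move=> fc fc' la; pose r := (finsupp c `|` finsupp c')%fset.
have wide (b : {fsfun intpart -> rat with 0}) m : (finsupp b `<=` r)%fset ->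
    \sum_(la <- finsupp b) b la * elem_sym_part la m
    = \sum_(la <- r) b la * elem_sym_part la m.
  move=> br; rewrite (big_fset_incl _ br) // => mu _ /fsfun_dflt ->.
  by rewrite mul0r.
have [lar|] := boolP (la \in r); last first.
  by rewrite in_fsetU negb_or => /andP[/fsfun_dflt -> /fsfun_dflt ->].
apply/eqP; rewrite -subr_eq0; apply/eqP.
apply: (elem_sym_part_free (d := fun la => c la - c' la) (fset_uniq r)) => // m.
under eq_bigr do rewrite mulrBl.
by rewrite sumrB -!wide ?fsubsetUl ?fsubsetUr // -fc -fc' subrr.
Qed.

End Unique.

(** * The coefficients of the chromatic symmetric function of a tree *)

Section Expansion.

Local Open Scope classical_set_scope.
Local Open Scope ring_scope.

Variables (V : finType) (e : rel V).

Definition e_coef (la : intpart) : int :=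
  \sum_(mu <- intparts #|V|) (-1) ^+ (size la + size mu)
    * (num_connected_partitions e mu)%:Z * (brick_weight la mu)%:Z.

Lemma connected_partition_type (P : {set {set V}}) : connected_partition e P ->
  sumn [seq #|B| | B : {set V} in P] = #|V|
  /\ 0%N \notin [seq #|B| | B : {set V} in P].
Proof.
case/andP => /and3P[/eqP covP triP P0] _; split.
  rewrite sumnE big_image /= -cardsT -covP.
  exact: (eqP triP).
apply/negP => /mapP[B]; rewrite mem_enum => BP /esym/cards0_eq B0.
by rewrite -B0 BP in P0.
Qed.

Lemma num_parts_le (mu : intpart) : (size mu <= sumn mu)%N.
Proof.
elim: (parts mu) (intpart_pos mu) => //= k s IH.
by rewrite inE negb_or => /andP[k0 /IH]; lia.
Qed.

(** The coefficients of [X_T] in the elementary basis, in finitely many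
    variables: group the connected partitions by their type [mu], and then the
    tabloids of shape [mu] by their content [la]. *)
Lemma chromatic_elementary (R : comNzRingType) N (x : 'I_N.+1 -> R) :
  is_tree e ->
  \sum_(kappa : {ffun V -> 'I_N.+1} |
        [forall u, forall v, e u v ==> (kappa u != kappa v)])
     \prod_v x (kappa v)
  = \sum_(la <- intparts #|V|)
      (e_coef la)%:~R * \prod_(k <- parts la) elementary x k.
Proof.
move=> treeE; have [sym _ _ _ _] := treeE.
have [r [par [depth rootE]]] := tree_rooting treeE.
rewrite (proper_colorings_rooted sym rootE).
transitivity (\sum_(mu <- intparts #|V|) (-1) ^+ (#|V| + size mu)
    * (num_connected_partitions e mu)%:R * \prod_(k <- parts mu) powersum x k).
  rewrite (sum_by_type (type := fun P : {set {set V}} =>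
             [seq #|B| | B : {set V} in P]) (n := #|V|)); last first.
    by move=> P _ /connected_partition_type.
  rewrite big_seq [RHS]big_seq; apply: eq_bigr => mu.
  rewrite mem_intparts => /eqP smu; rewrite -mulrA mulrCA mulr_natl -sumr_const.
  apply: eq_big => [P|P /andP[cP Pmu]]; first by rewrite inE.
  rewrite -(perm_big _ Pmu) big_image /=; congr (_ * _).
  have szP : size mu = #|P| by rewrite -(perm_size Pmu) size_map -cardE.
  rewrite -szP -{1}smu -signr_odd oddB ?num_parts_le // -oddD smu.
  by rewrite signr_odd.
under [RHS]eq_bigr => la _ do rewrite rmorph_sum mulr_suml.
rewrite exchange_big big_seq [RHS]big_seq; apply: eq_bigr => mu.
rewrite mem_intparts => /eqP smu.
rewrite prod_powersum_tabloids ?intpart_pos //.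
rewrite (sum_by_type (type := flatten) (n := #|V|)); last first.
  move=> t; rewrite mem_tabloids => /andP[/eqP tmu t0] _.
  by rewrite sumn_flatten tmu smu.
rewrite mulr_sumr; apply: eq_bigr => la _.
transitivity ((-1) ^+ (#|V| + size mu) * (num_connected_partitions e mu)%:R
   * ((-1) ^+ (#|V| + size la) * (brick_weight la mu)%:R
      * \prod_(k <- parts la) elementary x k)); last first.
  rewrite !rmorphM rmorphXn rmorphN1 /= -!pmulrn.
  rewrite !exprD; set a := (-1) ^+ #|V|.
  have aa : a * a = 1 :> R by rewrite -expr2 sqrr_sign.
  by ring: aa.
congr (_ * _); rewrite brick_weightE natr_sum mulr_sumr mulr_suml.
by apply: eq_bigr => t tla; rewrite (perm_big _ tla) (perm_size tla) smu.
Qed.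

Lemma chromatic_coef (m : {cmonom nat}) : is_tree e ->
  chromatic e m
  = \sum_(la <- intparts #|V|) (e_coef la)%:~R * elem_sym_part la m.
Proof.
move=> treeE; have [N mN] := exists_below m.
rewrite -(truncates_chromatic e mN).
have /= -> := @chromatic_elementary {malg rat[{cmonom nat}]} N
                 (fun i => << ucm (val i) >>) treeE.
rewrite raddf_sum /=.
apply: eq_bigr => la _.
by rewrite mulrzl raddfMz /= (truncates_elem_sym_part la mN) mulrzl.
Qed.

Lemma chromatic_e_expansion : is_tree e ->
  exists2 c, e_expansion (chromatic e) c &
    forall la : intpart, c la = if sumn la == #|V| then (e_coef la)%:~R else 0.
Proof.
move=> treeE; pose S := seq_fset tt (intparts #|V|).
pose c : {fsfun intpart -> rat with 0} := [fsfun la in S => (e_coef la)%:~R | 0].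
have cE (la : intpart) : c la = if sumn la == #|V| then (e_coef la)%:~R else 0.
  by rewrite fsfunE seq_fsetE mem_intparts.
exists c => // m; rewrite chromatic_coef //.
have pS : perm_eq (intparts #|V|) S.
  by rewrite perm_sym -[X in perm_eq _ X]undup_id ?undup_uniq // seq_fset_perm.
rewrite (perm_big _ pS) /=.
have cS : (finsupp c `<=` S)%fset.
  by apply/fsubsetP => la; rewrite mem_finsupp fsfunE; case: ifP; rewrite ?eqxx.
rewrite (big_fset_incl _ cS) => [|la _ /fsfun_dflt ->]; last by rewrite mul0r.
by rewrite big_seq [RHS]big_seq; apply: eq_bigr => la laS; rewrite fsfunE laS.
Qed.

Lemma e_positive_coef : is_tree e ->
  e_positive (chromatic e)
  <-> forall la : intpart, sumn la = #|V| -> 0 <= e_coef la.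
Proof.
move=> treeE; have [c Xc cE] := chromatic_e_expansion treeE.
split=> [[c' Xc' c'0] la lan|c0].
  by have := c'0 la; rewrite -(e_expansion_unique Xc Xc') cE lan eqxx ler0z.
by exists c => // la; rewrite cE; case: eqP => // /c0; rewrite ler0z.
Qed.

(** The term [mu = la] of the coefficient is the only one in which [mu] is
    refined by [la] without having fewer parts. *)
Lemma e_coef_diag (la : intpart) : sumn la = #|V| ->
  (e_coef la)%:~R = (num_connected_partitions e la)%:R * \prod_(k <- la) k%:R
    - \sum_(mu \in [set mu | refined_by mu la /\ (size mu < size la)%N])
           ((-1) ^+ (size la - size mu - 1)%N : rat)
           * (num_connected_partitions e mu)%:R * (brick_weight la mu)%:R :> rat.
Proof.
move=> lan; rewrite /e_coef rmorph_sum (bigD1_seq la) /=; first last.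
- exact: undup_uniq.
- by rewrite mem_intparts lan.
have nz (mu : intpart) : brick_weight la mu != 0%N -> mu != la ->
    refined_by mu la /\ (size mu < size la)%N.
  move=> /brick_weight_neq0 muref mula; split=> //.
  by have := refined_by_size muref; rewrite (negPf mula) orbF.
rewrite !rmorphM rmorphXn rmorphN1 /= -!pmulrn brick_weight_diag.
rewrite addnn -signr_odd odd_double mul1r natr_prod; congr (_ + _).
rewrite bigfs ?undup_uniq //; last first.
  move=> mu mula; rewrite mem_intparts => smu.
  have [w0|/nz w0] := eqVneq (brick_weight la mu) 0%N; first by rewrite w0 mulr0.
  by case/eqP: smu; rewrite -lan; apply/refined_by_sumn; case: (w0 mula).
rewrite -[RHS]mulN1r mulr_fsumr.
rewrite -(fsbig_widen [set mu | refined_by mu la /\ (size mu < size la)%N]);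
  first last.
- move=> mu [/= mula nref]; have [->|/nz w0] := eqVneq (brick_weight la mu) 0%N.
    by rewrite mulr0.
  by case: nref; apply: w0.
- by move=> mu [_ szmu] /=; apply: contraTneq szmu => ->; rewrite ltnn.
apply: eq_fsbigr => mu /set_mem[_ szmu].
rewrite !rmorphM rmorphXn rmorphN1 /= -!pmulrn !mulrA; congr (_ * _ * _).
have -> : (size la + size mu = (size la - size mu - 1).+1 + (size mu).*2)%N by lia.
by rewrite exprD exprS -mul2n exprM sqrrN !expr1n mulr1.
Qed.

End Expansion.

Local Open Scope classical_set_scope.
Local Open Scope ring_scope.

Theorem theorem2p5 (V : finType) (e : rel V) (n : nat)
    (hn : #|V| = n) (hT : is_tree e) :
  e_positive (chromatic e) <->
  (forall la : intpart, sumn la = n ->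
     (num_connected_partitions e la)%:Z >=
     Num.ceil
       ((\prod_(k <- la) k%:R : rat)^-1 *
        \sum_(mu \in [set mu | refined_by mu la /\ (size mu < size la)%N])
           ((-1) ^+ (size la - size mu - 1)%N : rat)
           * (num_connected_partitions e mu)%:R * (brick_weight la mu)%:R)).
Proof.
have coefP (la : intpart) : sumn la = n -> (0 <= e_coef e la) =
    (Num.ceil
       ((\prod_(k <- la) k%:R : rat)^-1 *
        \sum_(mu \in [set mu | refined_by mu la /\ (size mu < size la)%N])
           ((-1) ^+ (size la - size mu - 1)%N : rat)
           * (num_connected_partitions e mu)%:R * (brick_weight la mu)%:R)
     <= (num_connected_partitions e la)%:Z).
  (* As [b_la] is an integer, it bounds a rational exactly when it bounds its
     ceiling; the product of the parts is positive. *)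
  move=> lan; rewrite -(ler0z rat) e_coef_diag ?hn // subr_ge0.
  rewrite real_ceil_le_int ?num_real // ler_pdivrMl; last first.
    rewrite big_seq; apply: prodr_gt0 => k kla; rewrite ltr0n lt0n.
    by apply: contraTneq kla => ->; apply: intpart_pos.
  by rewrite mulrC.
rewrite e_positive_coef // hn.
by split=> c0 la lan; have := c0 la lan; rewrite coefP.
Qed.
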